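(* Let $G=(V,E,\mu,w)$ be a weighted graph with $\mathrm{Deg}(G)<\infty$ and $\inf_{x\in V}\mu_x>0$. Suppose that $G$ satisfies the 2-dimensional isoperimetric inequality, i.e. $$C_{IS}:=\inf_{\Omega}\frac{(w(\partial\Omega))^2}{\mu(\Omega)}>0,$$ where the infimum is taken over all nonempty finite subsets $\Omega\subset V$. Then for every function $u:V\to\mathbb{R}$ satisfying $\Delta u(x)+e^{u(x)}=0$ for all $x\in V$, $$\int_V e^u\ \geq\ \frac{C_{IS}}{\mathrm{Deg}(G)}.$$
   Context: A weighted graph $G=(V,E,\mu,w)$ consists of a simple, undirected, locally finite graph $(V,E)$ (vertex set $V$, edge set $E$; $x\sim y$ means $\{x,y\}\in E$), vertex weights $\mu:V\to(0,\infty)$, $x\mapsto\mu_x$, and symmetric edge weights $w:E\to(0,\infty)$, $\{x,y\}\mapsto w_{xy}=w_{yx}$. For $A\subset V$ and $B\subset E$ write $\mu(A)=\sum_{x\in A}\mu_x$ and $w(B)=\sum_{e\in B}w_e$. For a function $f$ on $V$, $\int_V f=\sum_{x\in V}f(x)\mu_x$; for the positive function $e^u$ this sum takes values in $[0,+\infty]$ (the inequality is trivially true when it is $+\infty$). The Laplacian is $\Delta u(x)=\frac{1}{\mu_x}\sum_{y\in V:\,y\sim x}w_{xy}(u(y)-u(x))$ for $u:V\to\mathbb{R}$, $x\in V$. The weighted degree is $\mathrm{Deg}(x)=\frac{1}{\mu_x}\sum_{y:\,y\sim x}w_{xy}$, and $\mathrm{Deg}(G)=\sup_{x\in V}\mathrm{Deg}(x)$.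 For a finite subset $\Omega\subset V$, the edge boundary is $\partial\Omega=\{\{x,y\}\in E: x\in\Omega,\ y\in V\setminus\Omega,\text{ or vice versa}\}$. *)

(* Defs.v *)
From HB Require Import structures.
From mathcomp Require Import all_boot all_order all_algebra finmap.
From mathcomp Require Import all_classical all_reals all_analysis.

Set Implicit Arguments.
Unset Strict Implicit.
Unset Printing Implicit Defensive.
Import Order.TTheory GRing.Theory Num.Theory.

Local Open Scope classical_set_scope.
Local Open Scope fset_scope.
Local Open Scope ring_scope.

(* An edge is an unordered pair, i.e., a two-element finite set, so the edge
   weights are symmetric by construction.  The values of [ewt] outside [edges]
   are never used. *)
Record weighted_graph (R : realType) (V : choiceType) := WeightedGraph {
  edges : set {fset V} ;
  vwt : V -> R ;
  ewt : {fset V} -> R ;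
  edges_simple : forall e, edges e -> #|` e| = 2%N ;
  locally_finite : forall x, finite_set [set y | edges [fset x; y]] ;
  vwt_gt0 : forall x, 0 < vwt x ;
  ewt_gt0 : forall e, edges e -> 0 < ewt e }.

Section WeightedGraph.
Context {R : realType} {V : choiceType}.
Variable G : weighted_graph R V.

Definition neighbours (x : V) : set V := [set y | edges G [fset x; y]].

Definition vmass (A : set V) : \bar R := \esum_(x in A) (vwt G x)%:E.

Definition emass (B : set {fset V}) : \bar R := \esum_(e in B) (ewt G e)%:E.

Definition laplacian (u : V -> R) (x : V) : R :=
  (vwt G x)^-1 * \sum_(y \in neighbours x) ewt G [fset x; y] * (u y - u x).

Definition wdeg (x : V) : R :=
  (vwt G x)^-1 * \sum_(y \in neighbours x) ewt G [fset x; y].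

Definition graph_deg : \bar R := ereal_sup [set (wdeg x)%:E | x in [set: V]].

Definition edge_boundary (Omega : set V) : set {fset V} :=
  [set e | edges G e /\
           exists x y, [/\ e = [fset x; y], Omega x & ~ Omega y]].

Definition isoperimetric_const : \bar R :=
  ereal_inf [set (emass (edge_boundary Omega) ^+ 2 / vmass Omega)%E
            | Omega in [set Omega | finite_set Omega /\ Omega !=set0]].

(* Meaningful for nonnegative [f] only, since [\esum] is. *)
Definition vintegral (f : V -> R) : \bar R :=
  \esum_(x in [set: V]) (f x * vwt G x)%:E.

End WeightedGraph.

(* Main.v *)
(** Let [f = e^u] and [M] be its total mass, assumed finite.  As the vertex
    weights are bounded below, the superlevel sets [{f > t}], [t > 0], are
    finite.  Writing [B_t] for the boundary edges [xy] of [{f > t}], with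
    [f y <= t < f x], the isoperimetric inequality and Cauchy-Schwarz give
      [C mu{f > t} <= (sum_(B_t) w)^2
                   <= (sum_(B_t) w (u x - u y)) (sum_(B_t) w / (u x - u y))],
    and by summation by parts the first factor is the mass of [f] on
    [{f > t}], hence at most [M].  Integrating over [t >= eps] bounds
    [C sum_(f > eps) (f - eps) mu] by
      [M sum_(f y < f x) w (f x - f y) / (u x - u y) <= M sum_x f x sum_y w
                                                     <= Deg M^2],
    and letting [eps] go to [0] yields [C M <= Deg M^2].  The integral over [t]
    is that of a step function, so it is computed as a finite sum over the gaps
    between consecutive breakpoints. *)

Require Import Defs.
From mathcomp Require Import all_boot all_order all_algebra finmap.
From mathcomp Require Import all_classical all_reals all_analysis.
From mathcomp Require Import ring lra.
Import Order.TTheory GRing.Theory Num.Theory.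
Local Open Scope classical_set_scope.
Local Open Scope ring_scope.

(** * Cauchy-Schwarz and integration of step functions as finite sums *)

(** Cauchy-Schwarz for [sqrt (w d)] and [sqrt (w / d)]: the quadratic [X l^2 - 2 W l + Y] is the sum
    of the nonnegative terms [w / d * (d l - 1)^2], so its discriminant is nonpositive. *)
Lemma sqr_sum_le_weighted (R : realType) (I : Type) (r : seq I) (P : pred I)
    (w d : I -> R) :
    (forall i, P i -> 0 <= w i) -> (forall i, P i -> 0 < d i) ->
  (\sum_(i <- r | P i) w i) ^+ 2 <=
  (\sum_(i <- r | P i) w i * d i) * (\sum_(i <- r | P i) w i / d i).
Proof.
move=> w0 d0.
set W := \sum_(i <- r | P i) w i; set X := \sum_(i <- r | P i) w i * d i.
set Y := \sum_(i <- r | P i) w i / d i.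
suff quad_ge0 l : 0 <= X * l ^+ 2 + (- (2 * W)) * l + Y.
  pose p := Poly [:: Y; - (2 * W); X].
  have p_ge0 x : 0 <= p.[x].
    by have := quad_ge0 x; rewrite /p horner_Poly /=; congr (0 <= _); ring.
  have := deg_le2_poly_ge0 (size_Poly _ : size p <= 3)%N p_ge0.
  by rewrite /p !coef_Poly /=; nra.
have -> : X * l ^+ 2 + (- (2 * W)) * l + Y =
    \sum_(i <- r | P i) w i / d i * (d i * l - 1) ^+ 2.
  rewrite /W mulr_sumr -sumrN !mulr_suml -!big_split /=.
  by apply: eq_bigr => i /d0 di; field; rewrite gt_eqF.
apply: sumr_ge0 => i Pi; rewrite mulr_ge0 ?sqr_ge0//.
by rewrite divr_ge0 ?w0// ltW ?d0.
Qed.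

(** Since [a] and [b] are breakpoints, each gap lies inside or outside [[a, b]], so its term is the
    increment of the clamping function [g]; the increments telescope. *)
Lemma sum_gaps_itv (R : realType) (s : seq R) (a b : R) :
    sorted <=%O s -> a \in s -> b \in s -> a <= b ->
  \sum_(0 <= k < (size s).-1) (s`_k.+1 - s`_k) * (a <= s`_k < b)%R%:R = b - a.
Proof.
move=> s_sorted sa sb ab; pose g v := Num.min (Num.max v a) b.
have s_nth i j : (i <= j < size s)%N -> s`_i <= s`_j.
  move=> /andP[ij js]; apply: (sorted_leq_nth le_trans le_refl) => //.
  exact: leq_ltn_trans js.
have gap c k : c \in s -> (k.+1 < size s)%N -> c <= s`_k \/ s`_k.+1 <= c.
  move=> cs ks; rewrite -(nth_index 0 cs).
  have [ik|ki] := leqP (index c s) k; [left|right]; apply: s_nth.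
    by rewrite ik (ltn_trans _ ks).
  by rewrite ki index_mem.
have s_gt0 : (0 < size s)%N by case: (s) sa.
have -> : b - a = g s`_(size s).-1 - g s`_0.
  have fst c : c \in s -> s`_0 <= c.
    by move=> cs; rewrite -(nth_index 0 cs) s_nth// index_mem.
  have lst c : c \in s -> c <= s`_(size s).-1.
    move=> cs; rewrite -{1}(nth_index 0 cs) s_nth// prednK// leqnn andbT.
    by rewrite -ltnS prednK// index_mem.
  rewrite /g (max_l (lst _ sa)) (min_r (lst _ sb)) (max_r (fst _ sa)).
  by rewrite (min_l ab).
apply: (telescope_sumr_eq (fun k => g s`_k)) => // k /andP[_ kn].
have ks : (k.+1 < size s)%N by rewrite -(prednK s_gt0) ltnS.
have kk : s`_k <= s`_k.+1 by apply: s_nth; rewrite leqnSn.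
rewrite /g; have [ak|ka] := gap a k sa ks; last first.
  rewrite (max_r ka) (max_r (le_trans kk ka)) subrr.
  (* The gap ends at or before [a], so its left endpoint can reach [a] only if the breakpoint is
     repeated and the gap has length 0. *)
  have [ak|] := lerP a s`_k; last by rewrite mulr0.
  have -> : s`_k = s`_k.+1 by apply/le_anti; rewrite kk (le_trans ka).
  by rewrite subrr mul0r.
rewrite ak /= !max_l// ?(le_trans ak)//.
have [bk|kb] := gap b k sb ks.
  by rewrite !min_r ?(le_trans bk)// ltNge bk subrr mulr0.
rewrite !min_l ?(le_trans kk)//; have [|bk] := ltrP s`_k b.
  by rewrite mulr1.
have -> : s`_k = s`_k.+1 by apply/le_anti; rewrite kk (le_trans kb).
by rewrite subrr mul0r.
Qed.

(** Integrates an inequality between step functions: both are constant on the gaps between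
    consecutive endpoints, so it suffices to compare them at the left end of each gap. *)
Lemma le_sum_itv_lengths (R : realType) (I J : Type) (r : seq I) (r' : seq J)
    (P : pred I) (Q : pred J) (a l h : I -> R) (a' l' h' : J -> R) :
    (forall i, P i -> l i <= h i) -> (forall j, Q j -> l' j <= h' j) ->
    (forall t, \sum_(i <- r | P i) a i * (l i <= t < h i)%R%:R <=
               \sum_(j <- r' | Q j) a' j * (l' j <= t < h' j)%R%:R) ->
  \sum_(i <- r | P i) a i * (h i - l i) <=
  \sum_(j <- r' | Q j) a' j * (h' j - l' j).
Proof.
move=> lh lh' step_le.
(* The endpoints of both families are merged, so that one subdivision computes both sides. *)
pose s := sort <=%O ([seq l i | i <- r] ++ [seq h i | i <- r] ++
                     [seq l' j | j <- r'] ++ [seq h' j | j <- r']).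
have s_sorted : sorted <=%O s by apply: sort_sorted; exact: le_total.
have lengthE (K : Type) (q : seq K) (S : pred K) (c x y : K -> R) :
    (forall k, S k -> x k <= y k) ->
    {subset [seq x k | k <- q] <= s} -> {subset [seq y k | k <- q] <= s} ->
    \sum_(k <- q | S k) c k * (y k - x k) =
    \sum_(0 <= n < (size s).-1) (s`_n.+1 - s`_n) *
      \sum_(k <- q | S k) c k * (x k <= s`_n < y k)%R%:R.
  move=> xy xs ys; under [RHS]eq_bigr do rewrite mulr_sumr.
  rewrite exchange_big /=.
  elim: q xs ys => [|k q IH] xs ys; first by rewrite !big_nil.
  rewrite !big_cons IH; last 2 first.
  - by move=> z zq; apply: xs; rewrite inE zq orbT.
  - by move=> z zq; apply: ys; rewrite inE zq orbT.
  case: ifPn => // Sk; congr (_ + _).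
  rewrite -(sum_gaps_itv _ s _ _ s_sorted (xs _ (mem_head _ _))
    (ys _ (mem_head _ _)) (xy _ Sk)) mulr_sumr.
  by apply: eq_bigr => n _; rewrite mulrCA.
rewrite !lengthE//;
  try by move=> z; rewrite mem_sort !mem_cat => ->; rewrite ?orbT.
apply: ler_sum_nat => n /andP[_ ns]; apply: ler_wpM2l (step_le _).
rewrite subr_ge0; apply: (sorted_leq_nth le_trans le_refl) => //.
- by rewrite inE (leq_trans ns)// leq_pred.
- by rewrite inE; case: (size s) ns.
Qed.

(** * Sums over pairs and cancellation of fluxes *)

Lemma sum_allpairs_cond (R : realType) (I J : Type) (r : seq I) (s : seq J)
    (P : pred I) (Q : pred J) (F : I -> J -> R) :
  \sum_(p <- [seq (x, y) | x <- r, y <- s] | P p.1 && Q p.2) F p.1 p.2 =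
  \sum_(x <- r | P x) \sum_(y <- s | Q y) F x y.
Proof.
rewrite big_mkcond big_allpairs /= [RHS]big_mkcond; apply: eq_bigr => x _.
by case: ifP => Px /=; [rewrite [RHS]big_mkcond|exact: big1].
Qed.

Lemma sum_antisym_eq0 (R : realType) (I : Type) (r : seq I) (P : pred I)
    (F : I -> I -> R) :
    (forall x y, F x y = - F y x) ->
  \sum_(x <- r | P x) \sum_(y <- r | P y) F x y = 0.
Proof.
move=> FN; set S := \sum_(x <- r | _) _.
suff : S = - S by lra.
rewrite {1}/S exchange_big /= -sumrN; apply: eq_bigr => x _.
by rewrite -sumrN; apply: eq_bigr => y _.
Qed.

(* Summation by parts: the fluxes through the edges inside [O] cancel. *)
Lemma sum_flux_boundary (R : realType) (V : choiceType) (O N : {fset V})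
    (w : V -> V -> R) (u : V -> R) :
    (O `<=` N)%fset -> (forall x y, w x y = w y x) ->
  \sum_(x <- O) \sum_(y <- N | y \notin O) w x y * (u x - u y) =
  \sum_(x <- O) \sum_(y <- N) w x y * (u x - u y).
Proof.
move=> /fsubsetP ON wC; pose F x y := w x y * (u x - u y).
transitivity (\sum_(x <- O) \sum_(y <- N | y \notin O) F x y +
              \sum_(x <- O) \sum_(y <- O) F x y).
  rewrite [X in _ = _ + X]sum_antisym_eq0 ?addr0// => x y.
  by rewrite /F wC -mulrN opprB.
rewrite -big_split /=; apply: eq_bigr => x _.
rewrite [RHS](bigID [in O]) /= addrC; congr (_ + _).
rewrite [RHS]big_fset_condE; suff <- : O = [fset y in N | y \in O]%fset by [].
apply/fsetP => y.
by rewrite !inE /=; case: (boolP (y \in O)) => [/ON ->|]; rewrite ?andbF.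
Qed.

(** * Isoperimetric estimates on superlevel sets *)

(** The estimate at a single level [t]: Cauchy-Schwarz with [d = u x - u y] splits the squared
    boundary weight, and the equation turns the outgoing flux into the mass of [expR u] on [O],
    which is at most [M]. *)
Lemma superlevel_isoperimetry (R : realType) (V : choiceType) (A N : {fset V})
    (w : V -> V -> R) (u mu : V -> R) (C eps M t : R) :
    (A `<=` N)%fset -> (forall x, (x \in A) = (eps < expR (u x))) ->
    (forall x y, w x y = w y x) -> (forall x y, 0 <= w x y) ->
    (forall x, 0 <= mu x) ->
    (forall x, x \in A ->
       \sum_(y <- N) w x y * (u x - u y) = expR (u x) * mu x) ->
    (forall O : {fset V}, (O `<=` A)%fset -> C * \sum_(x <- O) mu x <=
       (\sum_(x <- O) \sum_(y <- N | y \notin O) w x y) ^+ 2) ->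
    \sum_(x <- A) expR (u x) * mu x <= M -> eps <= t ->
  C * \sum_(x <- A | t < expR (u x)) mu x <=
  M * \sum_(x <- A | t < expR (u x)) \sum_(y <- N | expR (u y) <= t)
        w x y / (u x - u y).
Proof.
move=> AN inA wC w0 mu0 eqA isoA leM et.
pose O := [fset x in A | t < expR (u x)]%fset.
have OA : (O `<=` A)%fset by apply/fsubsetP => x; rewrite !inE => /andP[].
(* Because [eps <= t], vertices outside [A] also lie at or below level [t]. *)
have notinO : [pred y | y \notin O] =1 [pred y | expR (u y) <= t].
  move=> y; rewrite /= !inE inA /= leNgt; case: leP => //= ye.
  by rewrite ltNge (le_trans ye et).
have boundary (F : V -> V -> R) :
    \sum_(x <- O) \sum_(y <- N | y \notin O) F x y =
    \sum_(p <- [seq (x, y) | x <- A, y <- N] |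
        (t < expR (u p.1)) && (expR (u p.2) <= t)) F p.1 p.2.
  rewrite (sum_allpairs_cond _ _ _ _ _ (fun x => t < expR (u x))
    (fun y => expR (u y) <= t)) big_fset /=.
  by apply: eq_bigr => x _; exact: eq_bigl.
have gap p : (t < expR (u p.1)) && (expR (u p.2) <= t) -> 0 < u p.1 - u p.2.
  by case/andP => tx yt; rewrite subr_gt0 -ltr_expR (le_lt_trans yt tx).
rewrite big_fset_condE -/O; apply: (le_trans (isoA _ OA)).
have := sqr_sum_le_weighted _ _ [seq (x, y) | x <- A, y <- N] _
  (fun p => w p.1 p.2) (fun p => u p.1 - u p.2) (fun p _ => w0 p.1 p.2) gap.
rewrite -(boundary (fun x y => w x y)) => /le_trans; apply.
rewrite -(boundary (fun x y => w x y * (u x - u y))).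
rewrite sum_flux_boundary ?(fsubset_trans OA)//.
rewrite (sum_allpairs_cond _ _ _ _ _ (fun x => t < expR (u x))
    (fun y => expR (u y) <= t) (fun x y => w x y / (u x - u y))).
apply: ler_wpM2r.
  rewrite -(sum_allpairs_cond _ _ _ _ _ (fun x => t < expR (u x))
    (fun y => expR (u y) <= t) (fun x y => w x y / (u x - u y))).
  by apply: sumr_ge0 => p /gap gp; rewrite divr_ge0 ?w0// ltW.
apply: le_trans leM; rewrite big_fset /= big_mkcond big_seq [leRHS]big_seq.
apply: ler_sum => x xA; case: ifP => _; first by rewrite eqA.
by rewrite mulr_ge0 ?expR_ge0.
Qed.

(** Integrates the single-level estimate over [t >= eps]. A vertex [x] is active for [t] in
    [[eps, f x)], a pair [(x, y)] for [t] in [[max (f y) eps, f x)]; [Q] selects the pairs whose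
    interval is nonempty. *)
Lemma superlevel_mass_bound (R : realType) (V : choiceType) (A N : {fset V})
    (w : V -> V -> R) (u mu : V -> R) (C D eps M : R) :
    (A `<=` N)%fset -> (forall x, (x \in A) = (eps < expR (u x))) ->
    (forall x y, w x y = w y x) -> (forall x y, 0 <= w x y) ->
    (forall x, 0 <= mu x) ->
    (forall x, x \in A ->
       \sum_(y <- N) w x y * (u x - u y) = expR (u x) * mu x) ->
    (forall x, x \in A -> \sum_(y <- N) w x y <= D * mu x) -> 0 <= D ->
    (forall O : {fset V}, (O `<=` A)%fset -> C * \sum_(x <- O) mu x <=
       (\sum_(x <- O) \sum_(y <- N | y \notin O) w x y) ^+ 2) ->
    \sum_(x <- A) expR (u x) * mu x <= M ->
  C * \sum_(x <- A) mu x * (expR (u x) - eps) <= D * M ^+ 2.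
Proof.
move=> AN inA wC w0 mu0 eqA degA D0 isoA leM; pose f x := expR (u x).
have M0 : 0 <= M.
  by apply: le_trans leM; apply: sumr_ge0 => x _; rewrite mulr_ge0 ?expR_ge0.
pose r := [seq (x, y) | x <- A, y <- N].
pose below (p : V * V) := Num.max (f p.2) eps.
pose Q p := below p < f p.1.
have QP p : Q p -> eps < f p.1 /\ f p.2 < f p.1.
  by rewrite /Q /below gt_max => /andP[].
have step_le s : \sum_(x <- A | eps < f x) C * mu x * (eps <= s < f x)%R%:R <=
    \sum_(p <- r | Q p)
      M * (w p.1 p.2 / (u p.1 - u p.2)) * (below p <= s < f p.1)%R%:R.
  (* Below [eps] no interval is active and both sums vanish. *)
  have [es|se] := leP eps s; last first.
    rewrite big1 ?big1// => [p _|x _]; rewrite ?andFb ?mulr0//.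
    by rewrite ge_max (leNgt eps) se andbF mulr0.
  have := superlevel_isoperimetry _ _ _ _ _ _ _ _ _ _ _
    AN inA wC w0 mu0 eqA isoA leM es.
  congr (_ <= _).
    rewrite mulr_sumr [LHS]big_mkcond [RHS]big_mkcond; apply: eq_bigr => x _.
    rewrite -/(f x) /=; have [sx|sx] := ltP s (f x).
      by rewrite (le_lt_trans es sx) mulr1.
    by rewrite mulr0 if_same.
  rewrite -(sum_allpairs_cond _ _ _ _ _ (fun x => s < expR (u x))
    (fun y => expR (u y) <= s) (fun x y => w x y / (u x - u y))) mulr_sumr.
  rewrite [LHS]big_mkcond [RHS]big_mkcond; apply: eq_bigr => p _.
  rewrite -/(f p.1) -/(f p.2) /Q /below ge_max es andbT gt_max.
  have [sx|sx] := ltP s (f p.1); have [ys|ys] := leP (f p.2) s;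
    rewrite /= ?mulr0 ?if_same//.
  by rewrite (le_lt_trans ys sx) (le_lt_trans es sx) mulr1.
have := le_sum_itv_lengths _ _ _ _ _ _ _ _ _ _ _ _ _ _ _ step_le.
move=> /(_ (fun x => @ltW _ _ _ _) (fun p => @ltW _ _ _ _)) mass_le.
have -> : C * \sum_(x <- A) mu x * (expR (u x) - eps) =
    \sum_(x <- A | eps < f x) C * mu x * (f x - eps).
  rewrite mulr_sumr big_seq [RHS](eq_bigl [in A]) ?big_seq => [|x]; last first.
    by rewrite /= inA.
  by apply: eq_bigr => x _; rewrite mulrA.
apply: (le_trans mass_le).
have bound p : Q p -> M * (w p.1 p.2 / (u p.1 - u p.2)) * (f p.1 - below p) <=
    M * (w p.1 p.2 * f p.1).
  move=> /QP[_ fp]; have up : 0 < u p.1 - u p.2 by rewrite subr_gt0 -ltr_expR.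
  rewrite -mulrA ler_wpM2l// -mulrA ler_wpM2l// mulrC ler_pdivrMr//.
  (* convexity of [expR]: [e^a - e^b <= e^a (a - b)] *)
  have fp2 : f p.2 = f p.1 * expR (u p.2 - u p.1).
    by rewrite /f -expRD addrC subrK.
  have := expR_ge1Dx (u p.2 - u p.1).
  rewrite -(ler_pM2l (expR_gt0 (u p.1))) -/(f p.1) -fp2 => ?.
  have : f p.2 <= below p by rewrite le_max lexx.
  by lra.
apply: (le_trans (ler_sum _ bound)).
apply: (@le_trans _ _ (M * \sum_(x <- A) \sum_(y <- N) w x y * f x)).
  rewrite -mulr_sumr ler_wpM2l//.
  have := sum_allpairs_cond _ _ _ A N xpredT xpredT (fun x y => w x y * f x).
  rewrite /= => <-.
  rewrite big_mkcond; apply: ler_sum => p _; case: ifP => // _.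
  by rewrite mulr_ge0 ?expR_ge0.
(* The degree bound gives one factor [D] and the mass on [A] the second factor [M]. *)
rewrite expr2 mulrCA ler_wpM2l//; apply: le_trans (ler_wpM2l D0 leM).
rewrite mulr_sumr big_seq [leRHS]big_seq; apply: ler_sum => x xA.
by rewrite -mulr_suml mulrCA mulrC ler_wpM2l ?expR_ge0// degA.
Qed.

(** * Graph notions as finite sums *)

(** [s] may have repetitions, so an enumeration of edges by pairs can serve as [s] without a proof
    of injectivity. *)
Lemma le_sum_sub_seq (R : realType) (I : eqType) (r s : seq I) (F : I -> R) :
    uniq r -> {subset r <= s} -> {in s, forall i, 0 <= F i} ->
  \sum_(i <- r) F i <= \sum_(i <- s) F i.
Proof.
elim: s r => [|i s IH] r r_uniq rs F0.
  by case: r rs {r_uniq} => [|j r] rs //; have := rs j (mem_head _ _).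
have F0s : {in s, forall j, 0 <= F j} by move=> j js; rewrite F0 ?inE ?js ?orbT.
rewrite big_cons; have [ir|ir] := boolP (i \in r).
  rewrite (big_rem i ir) lerD2l IH ?rem_uniq// => j.
  rewrite (rem_filter _ r_uniq) mem_filter /= => /andP[/negPf ji /rs].
  by rewrite inE ji.
apply: le_trans (IH r r_uniq _ F0s) _; last by rewrite lerDr F0 ?mem_head.
move=> j jr; have := rs j jr; rewrite inE => /predU1P[ji|//].
by rewrite -ji jr in ir.
Qed.

(** Extension of the edge weights by 0 to all pairs, so that sums over neighbours become sums over
    any finite set containing them. *)
Definition adj_weight {R : realType} {V : choiceType} (G : weighted_graph R V)
    (x y : V) : R :=
  if [fset x; y]%fset \in edges G then ewt G [fset x; y]%fset else 0.

Section WeightedGraphLemmas.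
Context {R : realType} {V : choiceType} (G : weighted_graph R V).
Implicit Types (x y : V) (O N : {fset V}).

Lemma adj_weightC x y : adj_weight G x y = adj_weight G y x.
Proof. by rewrite /adj_weight fsetUC. Qed.

Lemma adj_weight_ge0 x y : 0 <= adj_weight G x y.
Proof. by rewrite /adj_weight; case: ifPn => // /set_mem /ewt_gt0/ltW. Qed.

Lemma sum_neighbours x N (g : V -> R) :
    (forall y, neighbours G x y -> y \in N) ->
  \sum_(y \in neighbours G x) ewt G [fset x; y]%fset * g y =
  \sum_(y <- N) adj_weight G x y * g y.
Proof.
move=> nbN; rewrite (fsbig_finite _ _ (locally_finite G x)).
rewrite -(@big_fset_incl _ _ _ _ (fset_set (neighbours G x)) N).
- rewrite big_seq [RHS]big_seq; apply: eq_bigr => y.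
  rewrite in_fset_set ?inE => [xy|]; last exact: locally_finite.
  by rewrite /adj_weight mem_set.
- apply/fsubsetP => y; rewrite in_fset_set; last exact: locally_finite.
  by move=> /set_mem /nbN.
- move=> y _; rewrite in_fset_set; last exact: locally_finite.
  move=> /negP xy; rewrite /adj_weight.
  case: ifPn => [/set_mem e|]; last by rewrite mul0r.
  by case: xy; exact: mem_set.
Qed.

Lemma wdegE x N : (forall y, neighbours G x y -> y \in N) ->
  \sum_(y <- N) adj_weight G x y = wdeg G x * vwt G x.
Proof.
move=> nbN; rewrite /wdeg mulrAC mulVf ?gt_eqF ?vwt_gt0// mul1r.
have := sum_neighbours _ _ (fun=> 1) nbN.
under [in RHS]eq_bigr do rewrite mulr1; move=> <-.
by apply: eq_fsbigr => y _; rewrite mulr1.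
Qed.

Lemma laplacianE (u : V -> R) x N : (forall y, neighbours G x y -> y \in N) ->
  \sum_(y <- N) adj_weight G x y * (u x - u y) = - laplacian G u x * vwt G x.
Proof.
move=> nbN; rewrite /laplacian mulNr mulrAC mulVf ?gt_eqF ?vwt_gt0// mul1r.
rewrite (sum_neighbours _ _ _ nbN) -sumrN.
by apply: eq_bigr => y _; rewrite -mulrN opprB.
Qed.

Lemma vmass_fset O : vmass G [set` O] = (\sum_(x <- O) vwt G x)%:E.
Proof.
rewrite /vmass esum_fset// => [|x _]; last by rewrite lee_fin ltW ?vwt_gt0.
by rewrite fsbig_finite// set_fsetK sumEFin.
Qed.

Lemma sum_le_vintegral (f : V -> R) O :
  ((\sum_(x <- O) f x * vwt G x)%:E <= vintegral G f)%E.
Proof.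
apply: esum_ge; exists [set` O] => //.
by rewrite fsbig_finite// set_fsetK sumEFin.
Qed.

(** Every boundary edge comes from one of the finitely many pairs with [x] in [O] and [y] in [N]
    outside [O]. *)
Lemma emass_boundary_le O N :
    (forall x y, x \in O -> neighbours G x y -> y \in N) ->
  exists2 b, emass G (edge_boundary G [set` O]) = b%:E &
    0 <= b <= \sum_(x <- O) \sum_(y <- N | y \notin O) adj_weight G x y.
Proof.
move=> nbN; set B := edge_boundary G [set` O].
pose s := [seq [fset x; y]%fset | x <- O, y <- [seq y <- N | y \notin O]].
have Bs e : B e -> e \in s.
  move=> [ee [x [y [exy /= xO /negP yO]]]]; rewrite exy.
  apply: (allpairs_f (fun x y => [fset x; y]%fset)) => //.
  by rewrite mem_filter yO (nbN x)// /neighbours /= -exy.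
have B_fin : finite_set B by apply: (sub_finite_set Bs); exact: finite_seq.
pose F e := if e \in edges G then ewt G e else 0.
have F0 e : 0 <= F e by rewrite /F; case: ifPn => // /set_mem /ewt_gt0/ltW.
have BE e : B e -> ewt G e = F e by move=> [ee _]; rewrite /F mem_set.
exists (\sum_(e <- fset_set B) F e).
  rewrite /emass esum_fset// => [|e /set_mem [ee _]]; last first.
    by rewrite lee_fin ltW ?ewt_gt0.
  rewrite fsbig_finite// -sumEFin big_seq [RHS]big_seq; apply: eq_bigr => e.
  by rewrite in_fset_set// => /set_mem/BE ->.
rewrite sumr_ge0//=; apply: (le_trans (le_sum_sub_seq _ _ _ s _ _ _ _)) => //.
  exact: fset_uniq.
  by move=> e; rewrite in_fset_set// => /set_mem/Bs.
by rewrite big_allpairs_dep; apply: ler_sum => x _; rewrite big_filter.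
Qed.

Lemma isoperimetric_fset (c : R) O N : isoperimetric_const G = c%:E ->
    (forall x y, x \in O -> neighbours G x y -> y \in N) ->
  c * \sum_(x <- O) vwt G x <=
  (\sum_(x <- O) \sum_(y <- N | y \notin O) adj_weight G x y) ^+ 2.
Proof.
(* The infimum covers nonempty sets only; for empty [O] both sides are 0. *)
move=> cE nbN; have [->|/fset0Pn[x0 x0O]] := eqVneq O fset0.
  by rewrite !big_seq_fset0 mulr0 expr0n.
have [b bE /andP[b0 bB]] := emass_boundary_le _ _ nbN.
have v0 : 0 < \sum_(x <- O) vwt G x.
  rewrite (big_rem x0)//= ltr_wpDr ?vwt_gt0// sumr_ge0// => x _.
  by rewrite ltW ?vwt_gt0.
have := @ereal_inf_lbound R _ _ (@imageP _ _
  (fun Omega => emass G (edge_boundary G Omega) ^+ 2 / vmass G Omega)%E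
  [set Omega | finite_set Omega /\ Omega !=set0] [set` O]
  (conj (finite_fset O) (ex_intro _ x0 x0O))).
rewrite -/(isoperimetric_const G) cE vmass_fset bE -EFin_expe inver gt_eqF//.
rewrite -EFinM lee_fin ler_pdivlMr// => /le_trans; apply.
by rewrite lerXn2r ?nnegrE// (le_trans b0).
Qed.

(** A singleton has finite boundary weight and positive mass, hence a finite quotient. *)
Lemma isoperimetric_const_lty (x : V) : (isoperimetric_const G < +oo)%E.
Proof.
pose N := fset_set (neighbours G x).
have nbN y z : y \in [fset x]%fset -> neighbours G y z -> z \in N.
  rewrite inE => /eqP -> xz; rewrite in_fset_set ?mem_set//.
  exact: locally_finite.
have [b bE _] := emass_boundary_le _ _ nbN.
apply: (@le_lt_trans _ _
  (emass G (edge_boundary G [set` [fset x]%fset]) ^+ 2 /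
   vmass G [set` [fset x]%fset])%E).
  apply: ereal_inf_lbound; exists [set` [fset x]%fset] => //.
  by split=> //; exists x; rewrite /= inE.
rewrite vmass_fset bE big_seq_fset1 -EFin_expe inver gt_eqF ?vwt_gt0//.
by rewrite -EFinM ltry.
Qed.

Lemma closed_neighbourhood O :
  exists2 N, (O `<=` N)%fset & forall x y, x \in O -> neighbours G x y -> y \in N.
Proof.
pose S := [set` O] `|` \bigcup_(x in [set` O]) neighbours G x.
have S_fin : finite_set S.
  rewrite finite_setU; split=> //; apply: bigcup_finite => // x _.
  exact: locally_finite.
exists (fset_set S).
  by apply/fsubsetP => x xO; rewrite in_fset_set// mem_set//; left.
by move=> x y xO xy; rewrite in_fset_set// mem_set//; right; exists x.
Qed.

(** * From superlevel sets to the total mass *)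

(** Markov's inequality: each vertex of the set contributes at least [eps * d], so more than
    [m / (eps * d)] of them would exceed the integral. *)
Lemma finite_superlevel (f : V -> R) (d eps m : R) :
    (forall x, d <= vwt G x) -> 0 < d -> 0 < eps ->
    vintegral G f = m%:E ->
  finite_set [set x | eps < f x].
Proof.
move=> dG d0 e0 fm; apply: contrapT.
move=> /(infinite_set_fset (Num.truncn (m / (eps * d))).+1)[B Bsub cardB].
have := sum_le_vintegral f B; rewrite fm lee_fin leNgt => /negP; apply.
apply: (@lt_le_trans _ _ (#|` B|%:R * (eps * d))).
  rewrite -ltr_pdivrMr ?mulr_gt0//; apply: lt_le_trans (truncnS_gt _) _.
  by rewrite ler_nat.
rewrite card_fset_sum1 natr_sum mulr_suml big_seq [leRHS]big_seq.
apply: ler_sum => x xB; rewrite mul1r ler_pM ?(ltW e0) ?(ltW d0)//.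
exact: ltW (Bsub x xB).
Qed.

Lemma liouville_mass_bound (u : V -> R) (c D d m : R) :
    (forall x, laplacian G u x + expR (u x) = 0) ->
    (forall x, d <= vwt G x) -> 0 < d ->
    isoperimetric_const G = c%:E -> 0 < c ->
    (forall x, wdeg G x <= D) -> 0 <= D ->
    vintegral G (fun x => expR (u x)) = m%:E ->
  c * m <= D * m ^+ 2.
Proof.
move=> liouville dG d0 cE c0 degD D0 mE.
(* Any finite [O] is allowed: its terms outside [A] are nonpositive, and the terms of [A] missing
   from [O] are nonnegative. *)
have level_bound eps O : 0 < eps ->
    c * \sum_(x <- O) vwt G x * (expR (u x) - eps) <= D * m ^+ 2.
  move=> e0; have Afin := finite_superlevel _ _ _ _ dG d0 e0 mE.
  pose A := fset_set [set x | eps < expR (u x)].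
  have inA x : (x \in A) = (eps < expR (u x)).
    by rewrite in_fset_set//; apply/idP/idP => [/set_mem//|?]; rewrite mem_set.
  have [N AN nbN] := closed_neighbourhood A.
  have A_bound : c * \sum_(x <- A) vwt G x * (expR (u x) - eps) <= D * m ^+ 2.
    apply: (superlevel_mass_bound _ _ A N (adj_weight G) _ _ _ _ _ _ AN inA
      adj_weightC adj_weight_ge0 (fun x => ltW (vwt_gt0 G x))) => //.
    - move=> x xA; rewrite laplacianE => [|y]; last exact: nbN.
      by congr (_ * _); have := liouville x; lra.
    - move=> x xA; rewrite wdegE => [|y]; last exact: nbN.
      by rewrite ler_wpM2r ?degD// ltW ?vwt_gt0.
    - move=> B /fsubsetP BA; apply: isoperimetric_fset => // x y /BA; exact: nbN.
    - by have := sum_le_vintegral (fun x => expR (u x)) A; rewrite mE lee_fin.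
  apply: le_trans A_bound.
  rewrite ler_wpM2l ?(ltW c0)//.
  apply: (@le_trans _ _
    (\sum_(x <- O | x \in A) vwt G x * (expR (u x) - eps))).
    rewrite [leRHS]big_mkcond; apply: ler_sum => x _; case: ifPn => //.
    by rewrite inA -leNgt => fx; rewrite mulr_ge0_le0 ?subr_le0// ltW ?vwt_gt0.
  rewrite -big_filter; apply: le_sum_sub_seq => [|x|x].
  - by rewrite filter_uniq.
  - by rewrite mem_filter => /andP[].
  - by rewrite inA => fx; rewrite mulr_ge0 ?subr_ge0 ?ltW ?vwt_gt0.
(* [m] is a supremum of finite sums, so each finite sum is bounded, up to an arbitrary [e > 0]. *)
rewrite -ler_pdivlMl// -lee_fin -mE; apply: ge_ereal_sup => _ [X [Xfin _] <-].
rewrite fsbig_finite// sumEFin lee_fin ler_pdivlMl//.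
set O := fset_set X; pose v := \sum_(x <- O) vwt G x.
have v0 : 0 <= v by apply: sumr_ge0 => x _; rewrite ltW ?vwt_gt0.
apply/ler_addgt0Pr => e e0.
(* Level [e / (c * v + 1)] makes the loss [c * v * eps] at most [e]; the 1 keeps the denominator
   positive when [v = 0]. *)
have k0 : 0 < c * v + 1 by rewrite ltr_wpDl// mulr_ge0// ltW.
have := level_bound (e / (c * v + 1)) O (divr_gt0 e0 k0).
under eq_bigr do rewrite mulrBr.
rewrite sumrB -mulr_suml -/v => bnd.
have : c * (v * (e / (c * v + 1))) <= e.
  by rewrite mulrA mulrCA ler_piMr ?ltW// ltr_pdivrMr// mul1r ltrDl.
under eq_bigr do rewrite mulrC.
by lra.
Qed.

End WeightedGraphLemmas.

(** * Reduction from extended reals to real constants *)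

Theorem theorem2p1 (R : realType) (V : choiceType) (G : weighted_graph R V)
  (Deg_fin : (graph_deg G < +oo)%E)
  (mu_inf_gt0 : (0 < ereal_inf [set (vwt G x)%:E | x in [set: V]])%E)
  (C_IS_gt0 : (0 < isoperimetric_const G)%E)
  (u : V -> R)
  (liouville : forall x, laplacian G u x + expR (u x) = 0) :
  (isoperimetric_const G / graph_deg G <= vintegral G (fun x => expR (u x)))%E.
Proof.
have [[x0 _]|noV] := pselect (exists x : V, True); last first.
  (* On an empty graph the quotient is [+oo / -oo = -oo]. *)
  have V0 : [set: V] = set0 by rewrite -subset0 => x _; case: noV; exists x.
  have -> : graph_deg G = -oo%E by rewrite /graph_deg V0 image_set0 ereal_sup0.
  by rewrite inveNy gt0_muleNy// leNye.
have deg_ge x : ((wdeg G x)%:E <= graph_deg G)%E.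
  by apply: ereal_sup_ubound; exists x.
have wdeg_ge0 : 0 <= wdeg G x0.
  have [N _ nbN] := closed_neighbourhood G [fset x0]%fset.
  rewrite -(pmulr_lge0 _ (vwt_gt0 G x0)) -(wdegE _ _ N) => [|y].
    by apply: sumr_ge0 => y _; exact: adj_weight_ge0.
  by apply: nbN; rewrite inE.
case DE : (graph_deg G) Deg_fin => [D| |] // _; last first.
  by have := deg_ge x0; rewrite DE.
have degD x : wdeg G x <= D by rewrite -lee_fin -DE.
case cE : (isoperimetric_const G) C_IS_gt0 => [c| |] //; last first.
  by have := isoperimetric_const_lty G x0; rewrite cE.
rewrite lte_fin => c0.
have mu_ge x : (ereal_inf [set (vwt G x)%:E | x in [set: V]] <= (vwt G x)%:E)%E.
  by apply: ereal_inf_lbound; exists x.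
case dE : (ereal_inf _) mu_inf_gt0 => [d| |] //; last first.
  by have := mu_ge x0; rewrite dE.
rewrite lte_fin => d0.
have dG x : d <= vwt G x by rewrite -lee_fin -dE.
case mE : (vintegral _ _) => [m| |]; [|exact: leey|]; last first.
  by have := sum_le_vintegral G (fun x => expR (u x)) fset0; rewrite mE.
have m0 : 0 < m.
  have := sum_le_vintegral G (fun x => expR (u x)) [fset x0]%fset.
  rewrite mE lee_fin big_seq_fset1; apply: lt_le_trans.
  by rewrite mulr_gt0 ?expR_gt0 ?vwt_gt0.
have := liouville_mass_bound _ _ _ _ _ _ liouville dG d0 cE c0 degD
  (le_trans wdeg_ge0 (degD x0)) mE.
rewrite expr2 mulrA ler_pM2r// => cDm.
(* Positivity of [D] follows from [c <= D * m] and makes the extended quotient the real number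
   [c / D]. *)
have D0 : 0 < D by rewrite -(pmulr_lgt0 _ m0); exact: lt_le_trans cDm.
by rewrite inver gt_eqF// -EFinM lee_fin ler_pdivrMr// mulrC.
Qed.
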